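(* Let $G$ be a group, $\mu\in L(G)$ and $\eta \in L(\mu)$. Then $\eta$ is a normal $L$-subgroup of $\mu$ if and only if $\eta^{a_z} \subseteq \eta$ for every $L$-point $a_z \in \mu$. Moreover, if $\eta \in NL(\mu)$ and $a_z\in\mu$ is an $L$-point with $\mathrm{tip}(\eta^{a_z}) = \mathrm{tip}(\eta)$, then $\eta^{a_z} = \eta$.
   Context: $L=\langle L,\le,\vee,\wedge\rangle$ is a completely distributive (complete) lattice with greatest element $1$ and least element $0$. An $L$-subset of $G$ is a function $G\to L$; $\eta\subseteq\mu$ means $\eta(x)\le\mu(x)$ for all $x\in G$. An $L$-subset $\mu$ of $G$ is an $L$-subgroup of $G$ if $\mu(xy)\ge\mu(x)\wedge\mu(y)$ and $\mu(x^{-1})=\mu(x)$ for all $x,y\in G$; $L(G)$ is the set of $L$-subgroups of $G$. For $\mu\in L(G)$, $L(\mu)$ denotes the set of $\eta\in L(G)$ with $\eta\subseteq\mu$. An $\eta\in L(\mu)$ is a normal $L$-subgroup of $\mu$ if $\eta(yxy^{-1})\ge\eta(x)\wedge\mu(y)$ for all $x,y\in G$; $NL(\mu)$ is the set of normal $L$-subgroups of $\mu$. The tip of $\eta$ is $\mathrm{tip}(\eta)=\bigvee_{x\in G}\eta(x)$. For $a\in L$ and $z\in G$, the $L$-point $a_z$ is the $L$-subset with value $a$ at $z$ and $0$ elsewhere; $a_z\in\mu$ means $\mu(z)\ge a$. For $\eta\in L(\mu)$ and $a_z\in\mu$, the conjugate of $\eta$ by $a_z$ is $\eta^{a_z}(x)=a\wedge\eta(zxz^{-1})$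 for all $x\in G$. *)

(* Defs.v *)
From HB Require Import structures.
From mathcomp Require Import all_boot all_order.
From mathcomp Require Import boolp classical_sets.

Set Implicit Arguments.
Unset Strict Implicit.
Unset Printing Implicit Defensive.

Import Order.TTheory.

Local Open Scope classical_set_scope.
Local Open Scope order_scope.

Section Lattices.
Context {d : Order.disp_t} {L : tbLatticeType d}.

(* The defaults \bot and \top are the values on set0; they are also what
   infimum and supremum return when the bound does not exist, hence the
   explicit completeness hypothesis below. *)
Definition Lsup (A : set L) : L := supremum \bot A.
Definition Linf (A : set L) : L := infimum \top A.

End Lattices.

Definition complete_lattice {d : Order.disp_t} (L : tbLatticeType d) : Prop :=
  forall A : set L, supremums A !=set0 /\ infimums A !=set0.

(* A complete lattice in which
     /\_(i : I) \/_(j : J i) a i j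
       = \/_(f : forall i, J i) /\_(i : I) a i (f i)
   for all index types; empty I and empty J i are allowed. *)
Definition completely_distributive {d : Order.disp_t} (L : tbLatticeType d)
    : Prop :=
  complete_lattice L /\
  forall (I : Type) (J : I -> Type) (a : forall i, J i -> L),
    Linf (range (fun i => Lsup (range (a i)))) =
    Lsup (range (fun f : forall i, J i => Linf (range (fun i => a i (f i))))).

Section LSubsets.
Context {d : Order.disp_t} {L : tbLatticeType d} {G : groupType}.
Implicit Types (mu eta : G -> L) (a : L) (x y z : G).

Definition Lsubset eta mu : Prop := forall x, eta x <= mu x.

Definition Lsubgroup mu : Prop :=
  (forall x y, mu x `&` mu y <= mu (x * y)%g) /\
  (forall x, mu x^-1%g = mu x).

Definition Lsubgroup_of mu eta : Prop := Lsubgroup eta /\ Lsubset eta mu.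

Definition normal_Lsubgroup_of mu eta : Prop :=
  Lsubgroup_of mu eta /\
  forall x y, eta x `&` mu y <= eta (y * x * y^-1)%g.

Definition tip eta : L := Lsup (range eta).

Definition Lpoint a z : G -> L := fun x => if x == z then a else \bot.

(* a_z \in mu, that is, Lpoint a z \in mu (see Lpoint_inE). *)
Definition Lpoint_in a z mu : Prop := a <= mu z.

Lemma Lpoint_inE a z mu : Lpoint_in a z mu <-> Lsubset (Lpoint a z) mu.
Proof.
split=> [az x|/(_ z)]; last by rewrite /Lpoint eqxx.
by rewrite /Lpoint; case: eqP => [->|_] //; exact: le0x.
Qed.

(* The conjugate of eta by the L-point a_z. *)
Definition Lconj eta a z : G -> L := fun x => a `&` eta (z * x * z^-1)%g.

End LSubsets.

(* Main.v *)
(* An L-subgroup attains its tip at 1, and so does its conjugate by a_z, with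
   value a `&` eta 1. Equality of the tips therefore says eta 1 <= a, so every
   value of eta lies below a <= mu z, and normality bounds eta below its
   conjugate. *)

Require Import Defs.
From HB Require Import structures.
From mathcomp Require Import all_boot all_order.
From mathcomp Require Import boolp classical_sets.

Import Order.TTheory.
Local Open Scope classical_set_scope.
Local Open Scope order_scope.

(** Serves to compute tips: an attained maximum is a least upper bound of the range. *)
Lemma Lsup_range_max (d : Order.disp_t) (L : tbLatticeType d) (T : Type)
    (f : T -> L) (t : T) : (forall x, f x <= f t) -> Lsup (range f) = f t.
Proof.
move=> ft; have f_max : supremums (range f) (f t).
  by split=> [_ [x _ <-]|y]; [exact: ft | apply; exists t].
(* The default [\bot] for an empty set is excluded by the value [f t]; otherwise some supremum is
   chosen, and suprema are unique. *)
rewrite /Lsup /supremum; case: eqP => [f0|_].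
  by have : set0 (f t) by rewrite -f0; exists t.
by case: xgetP => [y _ /is_subset1_supremums|/(_ (f t))//]; exact.
Qed.

Lemma Lsubgroup_le1 (d : Order.disp_t) (L : tbLatticeType d) (G : groupType)
    (eta : G -> L) (x : G) : Lsubgroup eta -> eta x <= eta 1%g.
Proof. by case=> etaM etaV; have := etaM x x^-1%g; rewrite mulgV etaV meetxx. Qed.

Lemma tip_Lsubgroup (d : Order.disp_t) (L : tbLatticeType d) (G : groupType)
    (eta : G -> L) : Lsubgroup eta -> tip eta = eta 1%g.
Proof. by move=> etaG; apply: Lsup_range_max => x; exact: Lsubgroup_le1. Qed.

Lemma tip_Lconj (d : Order.disp_t) (L : tbLatticeType d) (G : groupType)
    (eta : G -> L) (a : L) (z : G) :
  Lsubgroup eta -> tip (Lconj eta a z) = a `&` eta 1%g.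
Proof.
move=> etaG; rewrite /tip (@Lsup_range_max _ _ _ _ 1%g) => [|x].
  by rewrite /Lconj mulg1 mulgV.
by rewrite /Lconj mulg1 mulgV leI2 // Lsubgroup_le1.
Qed.

Theorem proposition4p1 (d : Order.disp_t) (L : tbLatticeType d)
    (hL : completely_distributive L) (G : groupType) (mu eta : G -> L)
    (hmu : Lsubgroup mu) (heta : Lsubgroup_of mu eta) :
  (normal_Lsubgroup_of mu eta <->
     (forall (a : L) (z : G), Lpoint_in a z mu -> Lsubset (Lconj eta a z) eta))
  /\
  (normal_Lsubgroup_of mu eta ->
     forall (a : L) (z : G), Lpoint_in a z mu ->
       tip (Lconj eta a z) = tip eta -> Lconj eta a z = eta).
Proof.
have [etaG _] := heta; have [_ muV] := hmu.
have conj_sub : normal_Lsubgroup_of mu eta -> forall a z, Lpoint_in a z mu ->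
    Lsubset (Lconj eta a z) eta.
  move=> [_ etaN] a z az x.
  (* Conjugating back by [z^-1] recovers [x], and [mu z^-1 = mu z] is at least [a]. *)
  have := etaN (z * x * z^-1)%g z^-1%g.
  rewrite muV invgK !mulgA mulVg mul1g mulgVK; apply: le_trans.
  by rewrite meetC leI2.
split; first split=> // etaJ.
  split=> // x y.
  (* The value [mu y] is the largest that an [L]-point of [mu] at [y^-1] can take; evaluating this
     conjugate at [y * x * y^-1] brings [eta x] back. *)
  have /(_ (y * x * y^-1)%g) : Lsubset (Lconj eta (mu y) y^-1%g) eta.
    by apply: etaJ; rewrite /Lpoint_in muV.
  by rewrite /Lconj invgK !mulgA mulVg mul1g mulgVK meetC.
move=> etaN a z az; rewrite tip_Lconj // tip_Lsubgroup // => tipE.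
have le_a x : eta x <= a.
  by rewrite (le_trans (Lsubgroup_le1 _ _ _ _ x etaG)) // -tipE leIl.
apply/funext => x; apply/le_anti; rewrite conj_sub //= /Lconj lexI le_a /=.
(* Here the conjugating element is [z] itself, and the meet of [eta x] with [mu z] is just
   [eta x]. *)
by apply: le_trans (etaN.2 x z); rewrite lexI lexx (le_trans (le_a x)).
Qed.
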